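(* Let $R$ be an associative ring with identity, let $\mathcal{B}$ be a class of right $R$-modules such that $\mathrm{fd}(\mathcal{B}) < \infty$, and let $n$ be a non-negative integer. Then $\mathrm{fd}(\mathcal{I}(R)) \leq n$ implies $\mathrm{l.w.Ggl}_{\mathcal{B}}(R) \leq n$.
   Context: $\mathrm{Mod}(R)$ is the category of left $R$-modules and $\mathcal{I}(R)$ is the class of injective left $R$-modules. For a class $\mathcal{X}$ of modules, $\mathrm{fd}(\mathcal{X}) := \sup\{\mathrm{fd}(X) : X \in \mathcal{X}\}$, where $\mathrm{fd}$ is flat dimension. A left $R$-module $G$ is Gorenstein $\mathcal{B}$-flat if $G \cong \mathrm{Ker}(F^0 \to F^1)$ for some exact complex $\cdots \to F_1 \to F_0 \to F^0 \to F^1 \to \cdots$ of flat left $R$-modules which remains exact after applying $B \otimes_R -$ for every $B \in \mathcal{B}$. The class of all such modules is $\mathcal{GF}_{\mathcal{B}}$. For a left $R$-module $M$, $\mathrm{Gfd}_{\mathcal{B}}(M)$ is the $\mathcal{GF}_{\mathcal{B}}$-resolution dimension of $M$: the least $k \geq 0$ for which there is an exact sequence $0 \to G_k \to \cdots \to G_0 \to M \to 0$ with all $G_i \in \mathcal{GF}_{\mathcal{B}}$ ($\infty$ if no such $k$ exists). Finally $\mathrm{l.w.Ggl}_{\mathcal{B}}(R) := \sup\{\mathrm{Gfd}_{\mathcal{B}}(M) : M \in \mathrm{Mod}(R)\}$. *)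

(* Defs.v *)
From HB Require Import structures.
From mathcomp Require Import all_boot all_algebra.
From mathcomp Require Import boolp.
From mathcomp.multinomials Require Import freeg.

Set Implicit Arguments.
Unset Strict Implicit.
Unset Printing Implicit Defensive.

Import GRing.Theory.

Local Open Scope ring_scope.
Local Open Scope quotient_scope.

(* A left R-module is an [lmodType R]; a right R-module is an [lmodType R^c],
   with  a . r  written  (r : R^c) *: a.  The zero ring is allowed. *)

Section Tensor.
Variables (R : pzRingType) (A : lmodType R^c) (M : lmodType R).

Definition balanced (Z : zmodType) (h : A -> M -> Z) : Prop :=
  [/\ forall a a' m, h (a + a') m = h a m + h a' m,
      forall a m m', h a (m + m') = h a m + h a m' &
      forall a (r : R) m, h ((r : R^c) *: a) m = h a (r *: m)].

Local Notation free := {freeg (A * M)}.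

Inductive tensor_relation : free -> Prop :=
| TRel0 : tensor_relation 0
| TRelB x y : tensor_relation x -> tensor_relation y -> tensor_relation (x - y)
| TRelDl a a' m :
    tensor_relation (<< (a + a', m) >> - (<< (a, m) >> + << (a', m) >>))
| TRelDr a m m' :
    tensor_relation (<< (a, m + m') >> - (<< (a, m) >> + << (a, m') >>))
| TRelZ a (r : R) m :
    tensor_relation (<< ((r : R^c) *: a, m) >> - << (a, r *: m) >>).

Definition tensor_rel : pred free := fun x => `[< tensor_relation x >].

Lemma tensor_rel_zmod_closed : zmod_closed tensor_rel.
Proof.
split; first exact/asboolP/TRel0.
by move=> x y /asboolP hx /asboolP hy; exact/asboolP/TRelB.
Qed.

HB.instance Definition _ :=
  GRing.isZmodClosed.Build free tensor_rel tensor_rel_zmod_closed.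

Definition tensor_zmod : zmodClosed free :=
  GRing.ZmodClosed.clone free tensor_rel _.

Definition tensor : Type := @Quotient.quot free tensor_zmod.

HB.instance Definition _ := GRing.Zmodule.on tensor.
HB.instance Definition _ := Quotient.on tensor.

Definition tens (a : A) (m : M) : tensor := \pi_tensor << (a, m) >>.

Lemma pi_tensorE (x y : free) :
  (\pi_tensor x = \pi_tensor y) <-> tensor_relation (x - y).
Proof.
split.
  by move/eqP; rewrite -[_ == _]/(_ == _ %[mod Quotient.quot tensor_zmod])
    -Quotient.idealrBE => /asboolP.
move=> h; apply/eqP.
rewrite -[_ == _]/(_ == _ %[mod Quotient.quot tensor_zmod]).
by rewrite -Quotient.idealrBE; apply/asboolP.
Qed.

Lemma pi_tensorB (x y : free) :
  \pi_tensor (x - y) = \pi_tensor x - \pi_tensor y.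
Proof. exact: (raddfB (\pi_(Quotient.quot tensor_zmod))). Qed.

Lemma pi_tensorD (x y : free) :
  \pi_tensor (x + y) = \pi_tensor x + \pi_tensor y.
Proof. exact: (raddfD (\pi_(Quotient.quot tensor_zmod))). Qed.

Lemma tens_balanced : balanced tens.
Proof.
split=> *; rewrite /tens -?pi_tensorD; apply/pi_tensorE.
- exact: TRelDl.
- exact: TRelDr.
- exact: TRelZ.
Qed.

(* The additive map induced by [h]; meaningful when [h] is balanced. *)
Definition tensor_lift (Z : zmodType) (h : A -> M -> Z) (x : tensor) : Z :=
  fglift (fun am => h am.1 am.2 : ssrint.zmodule Z) (repr x).

Section Lift.
Variables (Z : zmodType) (h : A -> M -> Z) (h_bal : balanced h).

Let F : free -> Z := fglift (fun am => h am.1 am.2 : ssrint.zmodule Z).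

Let FB : {morph F : x y / x - y}.
Proof.
exact: (@lift_is_additive int (A * M)%type (ssrint.zmodule Z)
  (fun am => h am.1 am.2)).
Qed.

Let FU a m : F << (a, m) >> = h a m.
Proof. by rewrite /F liftU scale1r. Qed.

Let FD : {morph F : x y / x + y}.
Proof.
have F0 : F 0 = 0 by rewrite -[0 in LHS](subrr 0) FB subrr.
have FN z : F (- z) = - F z by rewrite -[- z]sub0r FB F0 sub0r.
by move=> x y; rewrite -[y in LHS]opprK FB FN opprK.
Qed.

Let F_rel x : tensor_relation x -> F x = 0.
Proof.
case: h_bal => hDl hDr hZ.
elim=> [|{}x y _ hx _ hy|a a' m|a m m'|a r m].
- by rewrite -[0 in LHS](subrr 0) FB subrr.
- by rewrite FB hx hy subrr.
- by rewrite FB FD !FU hDl subrr.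
- by rewrite FB FD !FU hDr subrr.
- by rewrite FB !FU hZ subrr.
Qed.

Lemma tensor_lift_pi x : tensor_lift h (\pi_tensor x) = F x.
Proof.
rewrite /tensor_lift -/F; apply/eqP; rewrite -subr_eq0 -FB; apply/eqP/F_rel.
by apply/pi_tensorE; rewrite reprK.
Qed.

Lemma tensor_liftE a m : tensor_lift h (tens a m) = h a m.
Proof. by rewrite tensor_lift_pi FU. Qed.

Lemma tensor_liftB : {morph tensor_lift h : x y / x - y}.
Proof.
move=> x y; rewrite -[x]reprK -[y]reprK -pi_tensorB !tensor_lift_pi.
exact: FB.
Qed.

End Lift.

Lemma tensor_ind (P : tensor -> Prop) :
  (forall a m, P (tens a m)) -> (forall x y, P x -> P y -> P (x - y)) ->
  forall x, P x.
Proof.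
move=> Pt PB x; rewrite -[x]reprK; move: (repr x) => {x} D.
have P0 : P 0 by have := PB _ _ (Pt 0 0) (Pt 0 0); rewrite subrr.
have PN z : P z -> P (- z) by move=> Pz; rewrite -sub0r; apply: PB.
have PD y z : P y -> P z -> P (y + z).
  by move=> Py Pz; rewrite -[z]opprK; apply: (PB _ _) => //; apply: PN.
have pi0 : \pi_tensor (0 : free) = 0 by rewrite -(subrr 0) pi_tensorB subrr.
rewrite -[D]freeg_repr; move: (FreegDefs.seq_of_prefreeg (repr D)) => s.
elim: s => [|[k [a m]] s IH].
  by have -> : [freeg [::]] = 0 :> free by []; rewrite pi0.
have -> : [freeg ((k, (a, m)) :: s)] = << (a, m) >> *~ k + [freeg s] :> free.
  apply/eqP/freeg_eqP=> x; rewrite coeffD raddfMz /= !coeff_Freeg.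
  rewrite precoeff_cons precoeff_cons precoeff_nil addr0 mulr1.
  by rewrite -mulrzr intz.
rewrite pi_tensorD; apply: (PD _ _) => //.
have Mn n : P (\pi_tensor (<< (a, m) >> *+ n)).
  elim: n => [|n IHn]; first by rewrite mulr0n pi0.
  by rewrite mulrS pi_tensorD; apply: (PD _ _) => //; apply: Pt.
case: k => n; first by rewrite -pmulrn.
by rewrite NegzE mulrNz -sub0r pi_tensorB pi0; apply: (PB _ _) => //; apply: Mn.
Qed.

End Tensor.

Section TensorMap.
Variables (R : pzRingType) (A A' : lmodType R^c) (M M' : lmodType R).
Variables (f : {linear A -> A'}) (g : {linear M -> M'}).

Definition tensor_map : tensor A M -> tensor A' M' :=
  tensor_lift (fun a m => tens (f a) (g m)).

Lemma tensor_map_balanced : balanced (fun a m => tens (f a) (g m)).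
Proof.
have [tDl tDr tZ] := tens_balanced A' M'.
by split=> *; rewrite ?linearD ?linearZ ?tDl ?tDr ?tZ.
Qed.

Lemma tensor_mapE a m : tensor_map (tens a m) = tens (f a) (g m).
Proof. exact: tensor_liftE tensor_map_balanced a m. Qed.

Lemma tensor_map_is_zmod_morphism : zmod_morphism tensor_map.
Proof. exact: tensor_liftB tensor_map_balanced. Qed.

HB.instance Definition _ :=
  GRing.isZmodMorphism.Build (tensor A M) (tensor A' M') tensor_map
    tensor_map_is_zmod_morphism.

End TensorMap.

Section Kernel.
Variables (R : pzRingType) (M N : lmodType R) (f : {linear M -> N}).

Definition ker_pred : pred M := fun x => f x == 0.

Lemma ker_submod_closed : submod_closed ker_pred.
Proof.
split; first by rewrite /in_mem /= /ker_pred linear0.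
move=> a x y /eqP fx /eqP fy.
by rewrite /in_mem /= /ker_pred linearP fx fy scaler0 addr0.
Qed.

HB.instance Definition _ :=
  GRing.isSubmodClosed.Build R M ker_pred ker_submod_closed.

Record ker_mod : Type := Ker { ker_val : M; _ : ker_val \in ker_pred }.

HB.instance Definition _ := [isSub for ker_val].
HB.instance Definition _ := [Choice of ker_mod by <:].
HB.instance Definition _ := [SubChoice_isSubLmodule of ker_mod by <:].

End Kernel.

Definition isomorphic (R : pzRingType) (M N : lmodType R) : Prop :=
  exists f : {linear M -> N}, bijective f.

Definition exact_at (U V W : zmodType) (f : U -> V) (g : V -> W) : Prop :=
  forall v, g v = 0 <-> exists u, f u = v.

Definition injective_module (R : pzRingType) (E : lmodType R) : Prop :=
  forall (M N : lmodType R) (i : {linear M -> N}) (f : {linear M -> E}),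
    injective i -> exists g : {linear N -> E}, forall x, g (i x) = f x.

Definition flat_left (R : pzRingType) (M : lmodType R) : Prop :=
  forall (A A' A'' : lmodType R^c) (f : {linear A -> A'})
    (g : {linear A' -> A''}),
    exact_at f g ->
    exact_at (tensor_map f (idfun : {linear M -> M}))
             (tensor_map g (idfun : {linear M -> M})).

Definition flat_right (R : pzRingType) (A : lmodType R^c) : Prop :=
  forall (M M' M'' : lmodType R) (f : {linear M -> M'})
    (g : {linear M' -> M''}),
    exact_at f g ->
    exact_at (tensor_map (idfun : {linear A -> A}) f)
             (tensor_map (idfun : {linear A -> A}) g).

Inductive enat := Fin of nat | Infty.

Coercion Fin : nat >-> enat.

Definition le_enat (x y : enat) : bool :=
  match x, y with
  | _, Infty => true
  | Infty, Fin _ => false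
  | Fin m, Fin n => (m <= n)%N
  end.

(* Infimum of a set of natural numbers, [Infty] when it is empty. *)
Definition inf_enat (P : nat -> Prop) : enat :=
  match pselect (exists k, `[< P k >]) with
  | left exP => Fin (ex_minn exP)
  | right _ => Infty
  end.

Lemma inf_enat_leP (P : nat -> Prop) (n : nat) :
  le_enat (inf_enat P) n <-> exists2 k, (k <= n)%N & P k.
Proof.
rewrite /inf_enat; case: pselect => [exP|noP] /=.
  case: ex_minnP => m /asboolP Pm m_min; split=> [le_mn|]; first by exists m.
  by case=> k le_kn Pk; rewrite (leq_trans _ le_kn) // m_min //; apply/asboolP.
by split=> // -[k _ Pk]; case: noP; exists k; apply/asboolP.
Qed.

(* Supremum of a dimension over a class of modules: its least upper bound. *)
Definition sup_dim (R : pzRingType) (dim : lmodType R -> enat)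
    (C : lmodType R -> Prop) : enat :=
  inf_enat (fun n => forall M, C M -> le_enat (dim M) n).

Lemma sup_dim_leP (R : pzRingType) (dim : lmodType R -> enat)
    (C : lmodType R -> Prop) (n : nat) :
  le_enat (sup_dim dim C) n <-> forall M, C M -> le_enat (dim M) n.
Proof.
rewrite inf_enat_leP; split=> [[k le_kn dimC] M /dimC|dimC]; last by exists n.
by case: (dim M) => //= m /leq_trans; apply.
Qed.

(* An exact sequence 0 -> G_k -> ... -> G_0 -> M -> 0 with every G_i in X; it
   is indexed by all of nat, with G_i = 0 for i > k. *)
Definition has_resolution (R : pzRingType) (X : lmodType R -> Prop)
    (M : lmodType R) (k : nat) : Prop :=
  exists (G : nat -> lmodType R) (d : forall i, {linear G i.+1 -> G i})
    (e : {linear G 0%N -> M}),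
    [/\ forall i, (i <= k)%N -> X (G i),
        forall i, (k < i)%N -> forall x : G i, x = 0,
        forall i, exact_at (d i.+1) (d i),
        exact_at (d 0%N) e &
        forall m, exists x, e x = m].

Definition resolution_dim (R : pzRingType) (X : lmodType R -> Prop)
    (M : lmodType R) : enat :=
  inf_enat (has_resolution X M).

Definition fd_left (R : pzRingType) (M : lmodType R) : enat :=
  resolution_dim (@flat_left R) M.

Definition fd_right (R : pzRingType) (A : lmodType R^c) : enat :=
  resolution_dim (@flat_right R) A.

(* A sequence ... -> F_1 -> F_0 -> F^0 -> F^1 -> ... *)
Record biseq (R : pzRingType) := Biseq {
  seq_lo : nat -> lmodType R;
  seq_up : nat -> lmodType R;
  diff_lo : forall i, {linear seq_lo i.+1 -> seq_lo i};
  diff_mid : {linear seq_lo 0%N -> seq_up 0%N};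
  diff_up : forall i, {linear seq_up i -> seq_up i.+1} }.

Definition biseq_exact (R : pzRingType) (F : biseq R) : Prop :=
  [/\ forall i, exact_at (diff_lo F i.+1) (diff_lo F i),
      exact_at (diff_lo F 0%N) (diff_mid F),
      exact_at (diff_mid F) (diff_up F 0%N) &
      forall i, exact_at (diff_up F i) (diff_up F i.+1)].

Definition biseq_tensor_exact (R : pzRingType) (A : lmodType R^c)
    (F : biseq R) : Prop :=
  let t (M N : lmodType R) (f : {linear M -> N}) :=
    tensor_map (idfun : {linear A -> A}) f in
  [/\ forall i, exact_at (t _ _ (diff_lo F i.+1)) (t _ _ (diff_lo F i)),
      exact_at (t _ _ (diff_lo F 0%N)) (t _ _ (diff_mid F)),
      exact_at (t _ _ (diff_mid F)) (t _ _ (diff_up F 0%N)) &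
      forall i, exact_at (t _ _ (diff_up F i)) (t _ _ (diff_up F i.+1))].

Definition gorenstein_flat (R : pzRingType) (B : lmodType R^c -> Prop)
    (G : lmodType R) : Prop :=
  exists F : biseq R,
    [/\ (forall i, flat_left (seq_lo F i)) /\ (forall i, flat_left (seq_up F i)),
        biseq_exact F,
        forall A, B A -> biseq_tensor_exact A F &
        isomorphic G (ker_mod (diff_up F 0%N))].

Definition Gfd (R : pzRingType) (B : lmodType R^c -> Prop)
    (M : lmodType R) : enat :=
  resolution_dim (gorenstein_flat B) M.

Definition lwGgl (R : pzRingType) (B : lmodType R^c -> Prop) : enat :=
  sup_dim (Gfd B) (fun _ : lmodType R => True).

(* Main.v *)
Require Import Defs.
From HB Require Import structures.
From mathcomp Require Import all_boot all_algebra.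
From mathcomp Require Import boolp classical_sets functions.

Set Implicit Arguments.
Unset Strict Implicit.
Unset Printing Implicit Defensive.

Import GRing.Theory Num.Theory.

Local Open Scope ring_scope.

(** Let M be a left module and 0 -> M -> I^0 -> I^1 -> ... an injective
resolution.  Every I^j has flat dimension at most n, so the n-th syzygy of M,
taken along a suitable sequence of projective modules, has a coresolution by
the n-th syzygies of the I^j, which are flat.  Splicing it with a projective
resolution gives an exact complex of flat modules, and exactness survives
tensoring with a module of finite flat dimension.  So the n-th syzygy is
Gorenstein B-flat; the projective modules in between are Gorenstein B-flat
too, and M has a resolution of length n of the required kind.

The argument avoids Tor and uses only the following facts.

- Syzygies are taken one at a time, for all of the coresolution at once
  ([coresolved_syzygy]).  This is the horseshoe lemma applied to the short
  exact sequences of cycles 0 -> Z^j -> I^j -> Z^(j+1) -> 0: with projective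
  P^j covering Z^j, the module P^j x P^(j+1) covers I^j, and the kernels of
  these covers form a coresolution of the kernel of P^0 -> M.

- A syzygy of a module of flat dimension at most n + 1 has flat dimension at
  most n, whatever projective cover is used ([resolved_flat_syzygy]).  This is
  Schanuel's lemma together with the closure of the class of flat dimension at
  most n under kernels of epimorphisms onto flat modules
  ([resolved_flat_kernel]), which rests on the purity of submodules with flat
  quotient ([flat_quotient_pure]).

- If A has a finite flat resolution, tensoring with A preserves exactness of a
  sequence of flat modules that continues exactly to the right
  ([tensor_flat_exact]): by induction on the length, a short exact sequence
  0 -> K -> Q -> A -> 0 yields a short exact sequence of complexes whose first
  two terms are exact.

The ingredients from module theory are that free modules are flat, on both
sides ([tensor_free_left], [tensor_free_right]), and that there are enough
injective modules ([exact_to_injective]): an abelian group embeds in a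
divisible group D, the module of additive maps R -> D is injective, and it
receives enough maps. *)

(** * Linear maps, kernels and choice *)

Definition onto (U V : Type) (f : U -> V) : Prop :=
  forall y, exists x, f x = y.

Lemma exact_comp0 (U V W : zmodType) (f : U -> V) (g : V -> W) u :
  exact_at f g -> g (f u) = 0.
Proof. by move=> ex; apply/ex; exists u. Qed.

Lemma inj_eq0 (U V : zmodType) (f : {additive U -> V}) x :
  injective f -> f x = 0 -> x = 0.
Proof. by move=> fi fx; apply: fi; rewrite fx raddf0. Qed.

Lemma dep_choice (I : Type) (T : I -> Type) (P : forall i, T i -> Prop) :
  (forall i, exists x, P i x) -> exists f : forall i, T i, forall i, P i (f i).
Proof.
move=> h; exists (fun i => projT1 (cid (h i))) => i.
exact: (projT2 (cid (h i))).
Qed.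

Lemma linear_of (R : pzRingType) (M N : lmodType R) (f : M -> N) :
  linear f -> exists g : {linear M -> N}, g =1 f.
Proof.
move=> fl.
by exists (HB.pack f (GRing.isLinear.Build R M N *:%R f fl) : {linear M -> N}).
Qed.

Lemma linear_inverse (R : pzRingType) (M N : lmodType R) (f : {linear M -> N}) :
  injective f -> onto f ->
  exists g : {linear N -> M}, cancel f g /\ cancel g f.
Proof.
move=> fi /choice[g gK].
have [|h hE] := @linear_of _ _ _ g.
  by move=> a x y; apply: fi; rewrite linearP !gK.
by exists h; split=> x; rewrite hE //; apply: fi; rewrite gK.
Qed.

Lemma ker_incl (R : pzRingType) (M N : lmodType R) (f : {linear M -> N}) :
  exists i : {linear ker_mod f -> M}, injective i /\ exact_at i f.
Proof.
exists (\val : {linear ker_mod f -> M}); split; first exact: val_inj.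
move=> x; split=> [fx|[y <-]]; last by apply/eqP; exact: (valP y).
by exists (Ker (introT eqP fx : x \in ker_pred f)).
Qed.

(** The universal property of a kernel, for any injection that represents it;
all maps into kernels below are obtained in this way. *)
Lemma mono_lift (R : pzRingType) (X K M N : lmodType R) (i : {linear K -> M})
    (f : {linear M -> N}) (h : {linear X -> M}) :
  injective i -> exact_at i f -> (forall x, f (h x) = 0) ->
  exists k : {linear X -> K}, forall x, i (k x) = h x.
Proof.
move=> ii ex fh.
have /choice[k kE] : forall x, exists y, i y = h x by move=> x; apply/ex.
have [|g gE] := @linear_of _ _ _ k; last by exists g => x; rewrite gE.
by move=> a x y; apply: ii; rewrite kE !linearP !kE.
Qed.

(** * Free and projective modules *)

Definition projective_module (R : pzRingType) (P : lmodType R) : Prop :=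
  forall (M N : lmodType R) (p : {linear M -> N}) (f : {linear P -> N}),
    onto p -> exists g : {linear P -> M}, forall x, p (g x) = f x.

Section FreeModule.
Variables (T : pzRingType) (S : choiceType).

(** The free module on [S] is the submodule of finitely supported functions.
The values are taken in the regular module [T^o], so that the same construction
gives free right modules over [R] when [T] is [R^c]. *)
Definition finsupp_pred : pred (S -> T^o) :=
  fun u => `[< exists s : seq S, forall x, x \notin s -> u x = 0 >].

Lemma finsupp_submod_closed : submod_closed finsupp_pred.
Proof.
split; first by apply/asboolP; exists [::].
move=> a u v /asboolP[s us] /asboolP[t vt]; apply/asboolP; exists (s ++ t) => x.
rewrite mem_cat negb_or => /andP[/us ux /vt vx].
by rewrite [LHS](_ : _ = a *: u x + v x) // ux vx scaler0 addr0.
Qed.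

HB.instance Definition _ :=
  GRing.isSubmodClosed.Build T (S -> T^o) finsupp_pred finsupp_submod_closed.

Record free_mod : Type :=
  FreeMod { free_val : S -> T^o; _ : free_val \in finsupp_pred }.

HB.instance Definition _ := [isSub for free_val].
HB.instance Definition _ := [Choice of free_mod by <:].
HB.instance Definition _ := [SubChoice_isSubLmodule of free_mod by <:].

Definition fcoord (x : S) (u : free_mod) : T := free_val u x.
Arguments fcoord : simpl never.

Lemma fcoordP (u v : free_mod) : fcoord^~ u =1 fcoord^~ v -> u = v.
Proof. by move=> uv; apply: val_inj; apply: funext. Qed.

Lemma fcoordD x : {morph fcoord x : u v / u + v}. Proof. by []. Qed.
Lemma fcoordB x : {morph fcoord x : u v / u - v}. Proof. by []. Qed.
Lemma fcoordZ x a u : fcoord x (a *: u) = a * fcoord x u. Proof. by []. Qed.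

Lemma free_gen_subproof (x : S) :
  (fun y => (y == x)%:R : T^o) \in finsupp_pred.
Proof.
by apply/asboolP; exists [:: x] => y; rewrite inE => /negPf ->.
Qed.

Definition free_gen (x : S) : free_mod := FreeMod (free_gen_subproof x).

Lemma fcoord_gen x y : fcoord y (free_gen x) = (y == x)%:R. Proof. by []. Qed.

Lemma free_supp_ex (u : free_mod) :
  exists s : seq S, forall x, x \notin s -> fcoord x u = 0.
Proof. by have /asboolP := valP u. Qed.

(** Some finite set outside of which the coordinates vanish; the choice is
immaterial by [free_extE]. *)
Definition free_supp (u : free_mod) : seq S :=
  undup (projT1 (cid (free_supp_ex u))).

Lemma free_suppP u x : x \notin free_supp u -> fcoord x u = 0.
Proof.
rewrite mem_undup => xu.
exact: (projT2 (cid (free_supp_ex u)) x xu).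
Qed.

Variable V : lmodType T.
Variable c : S -> V.

Definition free_ext (u : free_mod) : V :=
  \sum_(x <- free_supp u) fcoord x u *: c x.

Lemma free_extE (u : free_mod) (s : seq S) :
  uniq s -> {subset free_supp u <= s} ->
  free_ext u = \sum_(x <- s) fcoord x u *: c x.
Proof.
move=> us sub.
rewrite /free_ext [RHS](bigID (mem (free_supp u))) /=.
rewrite [X in _ + X]big1 ?addr0; last first.
  by move=> x xs; rewrite free_suppP ?scale0r.
rewrite -[RHS]big_filter; apply: perm_big; apply: uniq_perm.
- exact: undup_uniq.
- exact: filter_uniq.
by move=> x; rewrite mem_filter; case: (boolP (x \in _)) => //= /sub ->.
Qed.

Lemma free_ext_linear : linear free_ext.
Proof.
move=> a u v.
pose s := undup (free_supp u ++ free_supp v ++ free_supp (a *: u + v)).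
have us : uniq s by apply: undup_uniq.
have sub w :
    {subset w <= free_supp u ++ free_supp v ++ free_supp (a *: u + v)} ->
    {subset w <= s} by move=> h x /h; rewrite mem_undup.
rewrite !(@free_extE _ s) //; try by apply: sub => x; rewrite !mem_cat => ->;
  rewrite ?orbT.
rewrite scaler_sumr -big_split /=; apply: eq_bigr => x _.
by rewrite fcoordD fcoordZ scalerDl scalerA.
Qed.

Lemma free_ext_gen x : free_ext (free_gen x) = c x.
Proof.
rewrite (@free_extE _ (undup (x :: free_supp (free_gen x)))) ?undup_uniq //;
  last first.
  by move=> y ys; rewrite mem_undup inE ys orbT.
rewrite (bigD1_seq x) ?undup_uniq ?mem_undup ?mem_head //=.
rewrite fcoord_gen eqxx scale1r big1 ?addr0 // => y /negPf yx.
by rewrite fcoord_gen yx scale0r.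
Qed.

End FreeModule.

Lemma free_expand (T : pzRingType) (S : choiceType) (u : free_mod T S) s :
  uniq s -> {subset free_supp u <= s} ->
  u = \sum_(x <- s) fcoord x u *: free_gen T x.
Proof.
move=> us sub; apply: fcoordP => y.
have cs : fcoord y (\sum_(x <- s) fcoord x u *: free_gen T x)
         = \sum_(x <- s) fcoord x u * (y == x)%:R.
  by elim: (s) => [|z r IH]; rewrite ?big_nil ?big_cons // fcoordD IH.
rewrite cs; case: (boolP (y \in s)) => ys.
  rewrite (bigD1_seq y) //= eqxx mulr1 big1 ?addr0 // => x xy.
  by rewrite eq_sym (negPf xy) mulr0.
rewrite big_seq big1 => [|x xs].
  by rewrite free_suppP //; apply: contra ys; apply: sub.
by case: eqP ys => [->|]; rewrite ?xs // mulr0.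
Qed.

Lemma free_linear (T : pzRingType) (S : choiceType) (V : lmodType T)
    (c : S -> V) :
  exists g : {linear free_mod T S -> V}, forall x, g (free_gen T x) = c x.
Proof.
have [g gE] := linear_of (free_ext_linear c).
by exists g => x; rewrite gE free_ext_gen.
Qed.

Lemma free_linear_eq (T : pzRingType) (S : choiceType) (V : lmodType T)
    (f g : {linear free_mod T S -> V}) :
  (forall x, f (free_gen T x) = g (free_gen T x)) -> f =1 g.
Proof.
move=> fg u; rewrite (@free_expand _ _ u (free_supp u)) ?undup_uniq //.
by rewrite !linear_sum; apply: eq_bigr => x _; rewrite !linearZ /= fg.
Qed.

Lemma free_projective (T : pzRingType) (S : choiceType) :
  projective_module (free_mod T S).
Proof.
move=> M N p f psurj.
have [c cE] := choice (fun x => psurj (f (free_gen T x))).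
have [g gE] := free_linear c; exists g => x.
by apply: (free_linear_eq (f := p \o g)) => y /=; rewrite gE cE.
Qed.

Lemma free_cover (T : pzRingType) (M : lmodType T) :
  exists p : {linear free_mod T M -> M}, onto p.
Proof.
have [p pE] := free_linear (fun x : M => x).
by exists p => y; exists (free_gen T y).
Qed.

(** * Tensor products and right exactness *)

Section ZmodQuotient.
Local Open Scope quotient_scope.
Variables (V : zmodType) (S : V -> Prop).
Hypotheses (S0 : S 0) (SB : forall x y, S x -> S y -> S (x - y)).

Let qpred : pred V := fun v => `[< S v >].

Let qpred_closed : zmod_closed qpred.
Proof.
by split=> [|x y /asboolP Sx /asboolP Sy]; apply/asboolP => //; apply: SB.
Qed.

Let qzmod : zmodClosed V :=
  HB.pack qpred (GRing.isZmodClosed.Build V qpred qpred_closed).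

(** Quotients of abelian groups by a propositional subgroup are used to prove
exactness of tensor products and to build divisible groups; only the universal
map and its kernel matter. *)
Lemma zmod_quotient :
  exists (Q : zmodType) (p : {additive V -> Q}),
    (forall q, exists v, p v = q) /\ forall v, p v = 0 <-> S v.
Proof.
exists (Quotient.quot qzmod), (\pi_(Quotient.quot qzmod)); split=> [q|v].
  by exists (repr q); exact: reprK.
have <- : \pi_(Quotient.quot qzmod) 0 = 0 by rewrite raddf0.
split=> [/eqP|Sv].
  by rewrite -[_ == _]/(_ == _ %[mod Quotient.quot qzmod]) -Quotient.idealrBE
    subr0 => /asboolP.
apply/eqP; rewrite -[_ == _]/(_ == _ %[mod Quotient.quot qzmod]).
by rewrite -Quotient.idealrBE subr0; apply/asboolP.
Qed.

End ZmodQuotient.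

Section TensorBasics.
Variables (R : pzRingType) (A : lmodType R^c) (M : lmodType R).

Lemma tensDl (a a' : A) (m : M) : tens (a + a') m = tens a m + tens a' m.
Proof. by have [h _ _] := tens_balanced A M; apply: h. Qed.
Lemma tensDr (a : A) (m m' : M) : tens a (m + m') = tens a m + tens a m'.
Proof. by have [_ h _] := tens_balanced A M; apply: h. Qed.
Lemma tensZ (a : A) (r : R) (m : M) : tens ((r : R^c) *: a) m = tens a (r *: m).
Proof. by have [_ _ h] := tens_balanced A M; apply: h. Qed.
Lemma tens0l (m : M) : tens (0 : A) m = 0.
Proof. by apply: (addIr (tens 0 m)); rewrite -tensDl addr0 add0r. Qed.
Lemma tens0r (a : A) : tens a (0 : M) = 0.
Proof. by apply: (addIr (tens a 0)); rewrite -tensDr addr0 add0r. Qed.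
Lemma tensBl (a a' : A) (m : M) : tens (a - a') m = tens a m - tens a' m.
Proof. by apply: (addIr (tens a' m)); rewrite -tensDl !subrK. Qed.
Lemma tensBr (a : A) (m m' : M) : tens a (m - m') = tens a m - tens a m'.
Proof. by apply: (addIr (tens a m')); rewrite -tensDr !subrK. Qed.
Lemma tens_suml I (r : seq I) (a : I -> A) (m : M) :
  tens (\sum_(i <- r) a i) m = \sum_(i <- r) tens (a i) m.
Proof.
by elim: r => [|i r IH]; rewrite ?big_nil ?tens0l // !big_cons tensDl IH.
Qed.

Lemma tens_sumr I (r : seq I) (a : A) (m : I -> M) :
  tens a (\sum_(i <- r) m i) = \sum_(i <- r) tens a (m i).
Proof.
by elim: r => [|i r IH]; rewrite ?big_nil ?tens0r // !big_cons tensDr IH.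
Qed.

Lemma tensor_ext (Z : zmodType) (h k : {additive tensor A M -> Z}) :
  (forall a m, h (tens a m) = k (tens a m)) -> h =1 k.
Proof.
by move=> hk; elim/tensor_ind => // x y IHx IHy; rewrite !raddfB IHx IHy.
Qed.

Lemma tensor_universal (Z : zmodType) (h : A -> M -> Z) :
  balanced h ->
  exists H : {additive tensor A M -> Z}, forall a m, H (tens a m) = h a m.
Proof.
move=> hb.
exists (HB.pack (tensor_lift h) (GRing.isZmodMorphism.Build _ _ (tensor_lift h)
  (tensor_liftB hb)) : {additive tensor A M -> Z}) => a m.
exact: tensor_liftE.
Qed.

End TensorBasics.

Lemma tensor_map_comp (R : pzRingType) (A1 A2 A3 : lmodType R^c)
    (M1 M2 M3 : lmodType R) (f1 : {linear A1 -> A2}) (f2 : {linear A2 -> A3})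
    (g1 : {linear M1 -> M2}) (g2 : {linear M2 -> M3})
    (f : {linear A1 -> A3}) (g : {linear M1 -> M3}) :
  (forall a, f2 (f1 a) = f a) -> (forall m, g2 (g1 m) = g m) ->
  forall x, tensor_map f2 g2 (tensor_map f1 g1 x) = tensor_map f g x.
Proof.
move=> ff gg.
apply: (tensor_ext (h := tensor_map f2 g2 \o tensor_map f1 g1)) => a m.
by rewrite /= !tensor_mapE ff gg.
Qed.

Lemma tensor_map_comp0 (R : pzRingType) (A1 A2 A3 : lmodType R^c)
    (M1 M2 M3 : lmodType R) (f1 : {linear A1 -> A2}) (f2 : {linear A2 -> A3})
    (g1 : {linear M1 -> M2}) (g2 : {linear M2 -> M3}) :
  (forall a m, tens (f2 (f1 a)) (g2 (g1 m)) = 0) ->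
  forall x, tensor_map f2 g2 (tensor_map f1 g1 x) = 0.
Proof.
move=> fg0; apply: (tensor_ext (h := tensor_map f2 g2 \o tensor_map f1 g1)
  (k := \0)) => a m.
by rewrite /= !tensor_mapE fg0.
Qed.

Section RightExact.
Variables (R : pzRingType) (A B : lmodType R^c) (M N : lmodType R).
Variables (f : {linear A -> B}) (g : {linear M -> N}).
Hypotheses (fsurj : onto f) (gsurj : onto g).

Lemma tensor_map_surj : onto (tensor_map f g).
Proof.
move=> y; elim/tensor_ind: y => [b n|y z [x <-] [x' <-]].
  have [[a <-] [m <-]] := (fsurj b, gsurj n).
  by exists (tens a m); rewrite tensor_mapE.
by exists (x - x'); rewrite raddfB.
Qed.

(** The kernel of a tensor product of two epimorphisms is the subgroup generated
by the tensors that have a factor in one of the two kernels.  With [Z] the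
quotient by a subgroup [S] containing these tensors, the tensor of two elements
has an image in [Z] that depends only on the images of the elements under [f]
and [g]; this gives a map [B (x) N -> Z] through which the projection to [Z]
factors.  Right exactness in either variable is the case where the other map is
the identity. *)
Lemma tensor_map_ker (S : tensor A M -> Prop) :
  S 0 -> (forall x y, S x -> S y -> S (x - y)) ->
  (forall a m, f a = 0 -> S (tens a m)) ->
  (forall a m, g m = 0 -> S (tens a m)) ->
  forall x, tensor_map f g x = 0 -> S x.
Proof.
move=> S0 SB Sl Sr.
have [Z [p [_ pS]]] := zmod_quotient S0 SB.
have [[s sK] [t tK]] := (choice fsurj, choice gsurj).
have p_eq a a' m m' : f a = f a' -> g m = g m' -> p (tens a m) = p (tens a' m').
  move=> fa gm; apply/eqP; rewrite -subr_eq0 -raddfB; apply/eqP/pS.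
  have -> : tens a m - tens a' m' = tens (a - a') m - tens a' (m' - m).
    by rewrite tensBl tensBr opprB addrA subrK.
  by apply: SB; [apply: Sl | apply: Sr]; rewrite linearB ?fa ?gm subrr.
have [|H HE] := @tensor_universal _ B N Z (fun b n => p (tens (s b) (t n))).
  split=> [b b' n|b n n'|b r n].
  - by rewrite -raddfD -tensDl; apply: p_eq; rewrite // linearD !sK.
  - by rewrite -raddfD -tensDr; apply: p_eq; rewrite // linearD !tK.
  - by rewrite (p_eq _ ((r : R^c) *: s b) _ (t n)) ?tensZ //; first
      (by apply: p_eq; rewrite // linearZ !tK); rewrite linearZ !sK.
have Hp : (H \o tensor_map f g) =1 p.
  apply: tensor_ext => a m /=.
  by rewrite tensor_mapE HE; apply: p_eq; rewrite ?sK ?tK.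
by move=> x gx; apply/pS; rewrite -Hp /= gx raddf0.
Qed.

End RightExact.

Lemma tensor_right_exact (R : pzRingType) (A : lmodType R^c)
    (M N Q : lmodType R) (f : {linear M -> N}) (g : {linear N -> Q}) :
  exact_at f g -> onto g ->
  exact_at (tensor_map (idfun : {linear A -> A}) f)
           (tensor_map (idfun : {linear A -> A}) g).
Proof.
move=> ex gs y; split=> [|[x <-]]; last first.
  by apply: tensor_map_comp0 => a m; rewrite (exact_comp0 _ ex) tens0r.
move: y; apply: (@tensor_map_ker R A A N Q idfun g _ gs
  (fun y => exists x, tensor_map (idfun : {linear A -> A}) f x = y)) => /=.
- by move=> a; exists a.
- by exists 0; rewrite raddf0.
- by move=> _ _ [x <-] [x' <-]; exists (x - x'); rewrite raddfB.
- by move=> a m ->; exists 0; rewrite raddf0 tens0l.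
- by move=> a m /ex[m' <-]; exists (tens a m'); rewrite tensor_mapE.
Qed.

Lemma tensor_left_exact (R : pzRingType) (A B C : lmodType R^c) (M : lmodType R)
    (f : {linear A -> B}) (g : {linear B -> C}) :
  exact_at f g -> onto g ->
  exact_at (tensor_map f (idfun : {linear M -> M}))
           (tensor_map g (idfun : {linear M -> M})).
Proof.
move=> ex gs y; split=> [|[x <-]]; last first.
  by apply: tensor_map_comp0 => a m; rewrite (exact_comp0 _ ex) tens0l.
move: y; apply: (@tensor_map_ker R B C M M g idfun gs _
  (fun y => exists x, tensor_map f (idfun : {linear M -> M}) x = y)) => /=.
- by move=> a; exists a.
- by exists 0; rewrite raddf0.
- by move=> _ _ [x <-] [x' <-]; exists (x - x'); rewrite raddfB.
- by move=> a m /ex[a' <-]; exists (tens a' m); rewrite tensor_mapE.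
- by move=> a m ->; exists 0; rewrite raddf0 tens0r.
Qed.

(** * Projective modules are flat *)

Section FreeFlat.
Variables (R : pzRingType) (S : choiceType).

(** A tensor with a free module has coordinates [phi i x], and it is recovered
from them.  This makes free modules flat: an element killed by a map has
coordinates killed by that map, so the coordinates can be lifted one by one. *)
Lemma tensor_free_left (A : lmodType R^c) :
  exists phi : S -> {additive tensor A (free_mod R S) -> A},
    (forall i a u, phi i (tens a u) = (fcoord i u : R^c) *: a) /\
    forall x, exists s : seq S,
      uniq s /\ x = \sum_(i <- s) tens (phi i x) (free_gen R i).
Proof.
have /choice[phi phiE] : forall i,
    exists p : {additive tensor A (free_mod R S) -> A},
    forall a u, p (tens a u) = (fcoord i u : R^c) *: a.
  move=> i; apply: tensor_universal; split=> [a b u|a u v|a r u].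
  - by rewrite scalerDr.
  - by rewrite fcoordD scalerDl.
  - by rewrite fcoordZ scalerA.
exists phi; split=> // x.
(* Allowing all larger index sets makes the claim stable under differences. *)
suff [s sx] : exists s : seq S, forall t, uniq t -> {subset s <= t} ->
    x = \sum_(i <- t) tens (phi i x) (free_gen R i).
  exists (undup s); split; first exact: undup_uniq.
  by apply: sx => [|i]; rewrite ?undup_uniq ?mem_undup.
elim/tensor_ind: x => [a u|x y [s sx] [t ty]].
  exists (free_supp u) => t ut sub.
  rewrite [u in LHS](free_expand ut sub) tens_sumr; apply: eq_bigr => i _.
  by rewrite phiE tensZ.
exists (s ++ t) => r ur sub.
rewrite [x in LHS](sx r) // => [|i si]; last by apply: sub; rewrite mem_cat si.
rewrite [y in LHS](ty r) // => [|i ti]; last first.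
  by apply: sub; rewrite mem_cat ti orbT.
rewrite -sumrB; apply: eq_bigr => i _.
by rewrite raddfB tensBl.
Qed.

Lemma free_flat_left : flat_left (free_mod R S).
Proof.
move=> A A' A'' f g ex x.
split=> [gx|[y <-]]; last first.
  by apply: tensor_map_comp0 => a m; rewrite (exact_comp0 _ ex) tens0l.
have [p [pE pS]] := tensor_free_left A'.
have [q [qE _]] := tensor_free_left A''.
have [s [us ->]] := pS x.
have pg i : g (p i x) = 0.
  have -> : g (p i x) = q i (tensor_map g idfun x); last by rewrite gx raddf0.
  have := @tensor_ext _ _ _ _ (g \o p i) (q i \o tensor_map g idfun).
  by apply=> a m /=; rewrite tensor_mapE pE qE linearZ.
have /choice[b bE] : forall i, exists b, f b = p i x by move=> i; apply/ex.
exists (\sum_(i <- s) tens (b i) (free_gen R i)).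
by rewrite raddf_sum; apply: eq_bigr => i _; rewrite /= tensor_mapE bE.
Qed.

(** The mirror image of [tensor_free_left], needed because the two factors of a
tensor product have different kinds of module structure. *)
Lemma tensor_free_right (M : lmodType R) :
  exists phi : S -> {additive tensor (free_mod R^c S) M -> M},
    (forall i u m, phi i (tens u m) = (fcoord i u : R) *: m) /\
    forall x, exists s : seq S,
      uniq s /\ x = \sum_(i <- s) tens (free_gen R^c i) (phi i x).
Proof.
have /choice[phi phiE] : forall i,
    exists p : {additive tensor (free_mod R^c S) M -> M},
    forall u m, p (tens u m) = (fcoord i u : R) *: m.
  move=> i; apply: tensor_universal; split=> [u v m|u m n|u r m].
  - by rewrite fcoordD scalerDl.
  - by rewrite scalerDr.
  - by rewrite fcoordZ scalerA.
exists phi; split=> // x.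
suff [s sx] : exists s : seq S, forall t, uniq t -> {subset s <= t} ->
    x = \sum_(i <- t) tens (free_gen R^c i) (phi i x).
  exists (undup s); split; first exact: undup_uniq.
  by apply: sx => [|i]; rewrite ?undup_uniq ?mem_undup.
elim/tensor_ind: x => [u m|x y [s sx] [t ty]].
  exists (free_supp u) => t ut sub.
  rewrite [u in LHS](free_expand ut sub) tens_suml; apply: eq_bigr => i _.
  by rewrite phiE tensZ.
exists (s ++ t) => r ur sub.
rewrite [x in LHS](sx r) // => [|i si]; last by apply: sub; rewrite mem_cat si.
rewrite [y in LHS](ty r) // => [|i ti]; last first.
  by apply: sub; rewrite mem_cat ti orbT.
rewrite -sumrB; apply: eq_bigr => i _.
by rewrite raddfB tensBr.
Qed.

Lemma free_flat_right : flat_right (free_mod R^c S).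
Proof.
move=> M M' M'' f g ex x.
split=> [gx|[y <-]]; last first.
  by apply: tensor_map_comp0 => a m; rewrite (exact_comp0 _ ex) tens0r.
have [p [pE pS]] := tensor_free_right M'.
have [q [qE _]] := tensor_free_right M''.
have [s [us ->]] := pS x.
have pg i : g (p i x) = 0.
  have -> : g (p i x) = q i (tensor_map idfun g x); last by rewrite gx raddf0.
  have := @tensor_ext _ _ _ _ (g \o p i) (q i \o tensor_map idfun g).
  by apply=> a m /=; rewrite tensor_mapE pE qE linearZ.
have /choice[b bE] : forall i, exists b, f b = p i x by move=> i; apply/ex.
exists (\sum_(i <- s) tens (free_gen R^c i) (b i)).
by rewrite raddf_sum; apply: eq_bigr => i _; rewrite /= tensor_mapE bE.
Qed.

End FreeFlat.

Lemma flat_left_retract (R : pzRingType) (P F : lmodType R)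
    (s : {linear P -> F}) (r : {linear F -> P}) :
  (forall x, r (s x) = x) -> flat_left F -> flat_left P.
Proof.
move=> rs Ff A A' A'' f g ex x.
split=> [gx|[y <-]]; last first.
  by apply: tensor_map_comp0 => a m; rewrite (exact_comp0 _ ex) tens0l.
have [|y fy] := (Ff _ _ _ _ _ ex (tensor_map idfun s x)).1.
  rewrite (tensor_map_comp (f := g) (g := s)) //.
  rewrite -(tensor_map_comp (f1 := g) (f2 := idfun) (g1 := idfun) (g2 := s)) //.
  by rewrite gx raddf0.
exists (tensor_map idfun r y).
rewrite (tensor_map_comp (f := f) (g := r)) //.
rewrite -(tensor_map_comp (f1 := f) (f2 := idfun) (g1 := idfun) (g2 := r)) //.
rewrite fy (tensor_map_comp (f := idfun) (g := idfun)) //.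
exact: (tensor_ext (h := tensor_map idfun idfun) (k := idfun)
  (tensor_mapE _ _)).
Qed.

Lemma flat_right_retract (R : pzRingType) (P F : lmodType R^c)
    (s : {linear P -> F}) (r : {linear F -> P}) :
  (forall x, r (s x) = x) -> flat_right F -> flat_right P.
Proof.
move=> rs Ff A A' A'' f g ex x.
split=> [gx|[y <-]]; last first.
  by apply: tensor_map_comp0 => a m; rewrite (exact_comp0 _ ex) tens0r.
have [|y fy] := (Ff _ _ _ _ _ ex (tensor_map s idfun x)).1.
  rewrite (tensor_map_comp (f := s) (g := g)) //.
  rewrite -(tensor_map_comp (g1 := g) (g2 := idfun) (f1 := idfun) (f2 := s)) //.
  by rewrite gx raddf0.
exists (tensor_map r idfun y).
rewrite (tensor_map_comp (g := f) (f := r)) //.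
rewrite -(tensor_map_comp (g1 := f) (g2 := idfun) (f1 := idfun) (f2 := r)) //.
rewrite fy (tensor_map_comp (f := idfun) (g := idfun)) //.
exact: (tensor_ext (h := tensor_map idfun idfun) (k := idfun)
  (tensor_mapE _ _)).
Qed.

Lemma flat_left_iso (R : pzRingType) (M N : lmodType R) (f : {linear M -> N}) :
  injective f -> onto f -> flat_left M -> flat_left N.
Proof.
move=> fi fs; have [g [_ gK]] := linear_inverse fi fs.
exact: flat_left_retract gK.
Qed.

Lemma flat_right_iso (R : pzRingType) (M N : lmodType R^c)
    (f : {linear M -> N}) :
  injective f -> onto f -> flat_right M -> flat_right N.
Proof.
move=> fi fs; have [g [_ gK]] := linear_inverse fi fs.
exact: flat_right_retract gK.
Qed.

(** A projective module is a retract of a free one. *)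
Lemma projective_flat (R : pzRingType) (P : lmodType R) :
  projective_module P -> flat_left P.
Proof.
move=> Pp; have [p ps] := free_cover P.
have [s sK] := Pp _ _ p idfun ps.
exact: (flat_left_retract sK (@free_flat_left _ _)).
Qed.

(** * Kernels and products of flat modules *)

Lemma tensor_swap (R : pzRingType) (A B : lmodType R^c) (M N : lmodType R)
    (f : {linear A -> B}) (g : {linear M -> N}) (x : tensor A M) :
  tensor_map f (idfun : {linear N -> N})
    (tensor_map (idfun : {linear A -> A}) g x) =
  tensor_map (idfun : {linear B -> B}) g
    (tensor_map f (idfun : {linear M -> M}) x).
Proof. by rewrite !(tensor_map_comp (f := f) (g := g)). Qed.


Lemma flat_left_inj (R : pzRingType) (F : lmodType R) (A B : lmodType R^c)
    (f : {linear A -> B}) :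
  flat_left F -> injective f ->
  injective (tensor_map f (idfun : {linear F -> F})).
Proof.
move=> Ff fi; apply: raddf_inj => x fx.
have ex : exact_at (\0 : {linear A -> A}) f.
  move=> a; split=> [fa|[u <-]]; last by rewrite raddf0.
  by exists 0; rewrite (inj_eq0 fi fa).
have /(Ff _ _ _ _ _ ex)[y <-] := fx.
have := @tensor_ext _ _ _ _ (tensor_map (\0 : {linear A -> A}) idfun) (\0).
by apply=> a m; rewrite /= tensor_mapE tens0l.
Qed.

Lemma flat_right_inj (R : pzRingType) (F : lmodType R^c) (A B : lmodType R)
    (f : {linear A -> B}) :
  flat_right F -> injective f ->
  injective (tensor_map (idfun : {linear F -> F}) f).
Proof.
move=> Ff fi; apply: raddf_inj => x fx.
have ex : exact_at (\0 : {linear A -> A}) f.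
  move=> a; split=> [fa|[u <-]]; last by rewrite raddf0.
  by exists 0; rewrite (inj_eq0 fi fa).
have /(Ff _ _ _ _ _ ex)[y <-] := fx.
have := @tensor_ext _ _ _ _ (tensor_map idfun (\0 : {linear A -> A})) (\0).
by apply=> a m; rewrite /= tensor_mapE tens0r.
Qed.

Definition short_exact (R : pzRingType) (L Z F : lmodType R)
    (i : {linear L -> Z}) (p : {linear Z -> F}) : Prop :=
  [/\ injective i, exact_at i p & onto p].

(** The vanishing of Tor_1(A, F) for flat [F], in elementary form.  Cover [A] by
a free module [Q] with kernel [K] and chase the diagram with rows K, Q, A and
columns L, Z, F: tensoring with [Q] and with [F] is exact, and all tensor
products are right exact. *)
Lemma flat_quotient_pure (R : pzRingType) (L Z F : lmodType R)
    (i : {linear L -> Z}) (p : {linear Z -> F}) (A : lmodType R^c) :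
  short_exact i p -> flat_left F ->
  injective (tensor_map (idfun : {linear A -> A}) i).
Proof.
move=> [ii ex ps] Ff; apply: raddf_inj => x ix.
have [q qs] := free_cover A; have [k [ki kq]] := ker_incl q.
have [y qy] := tensor_map_surj qs (g := idfun) (fun m => ex_intro _ m erefl) x.
have /(tensor_left_exact kq qs)[z kz] :
    tensor_map q idfun (tensor_map idfun i y) = 0 by rewrite tensor_swap qy.
have /(tensor_right_exact ex ps)[w iw] : tensor_map idfun p z = 0.
  apply: (flat_left_inj Ff ki); rewrite tensor_swap kz raddf0.
  by apply: tensor_map_comp0 => a m; rewrite (exact_comp0 _ ex) tens0r.
have yw : y = tensor_map k idfun w.
  apply: (flat_right_inj (@free_flat_right _ _) ii).
  by rewrite -kz -iw tensor_swap.
rewrite -qy yw; apply: tensor_map_comp0 => a m.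
by rewrite (exact_comp0 _ kq) tens0l.
Qed.

(** By purity, tensoring L -> Z -> F with each of [A], [A'], [A''] gives a short
exact sequence.  An element of [A' (x) L] in the kernel of [g] has a preimage in
[A (x) Z] as [Z] is flat.  The preimage need not come from [A (x) L], but its
image in [A (x) F] comes from the kernel of [f] as [F] is flat, so it can be
corrected by an element that [f] kills. *)
Lemma flat_left_kernel (R : pzRingType) (L Z F : lmodType R)
    (i : {linear L -> Z}) (p : {linear Z -> F}) :
  short_exact i p -> flat_left Z -> flat_left F -> flat_left L.
Proof.
move=> se Zf Ff A A' A'' f g fg x; have [ii ex ps] := se.
split=> [gx|[y <-]]; last first.
  by apply: tensor_map_comp0 => a m; rewrite (exact_comp0 _ fg) tens0l.
have /(Zf _ _ _ _ _ fg)[z fz] : tensor_map g idfun (tensor_map idfun i x) = 0.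
  by rewrite tensor_swap gx raddf0.
have [k [ki kf]] := ker_incl f.
have /(Ff _ _ _ _ _ kf)[u ku] : tensor_map f idfun (tensor_map idfun p z) = 0.
  rewrite tensor_swap fz; apply: tensor_map_comp0 => a m.
  by rewrite (exact_comp0 _ ex) tens0r.
have [v pv] := tensor_map_surj (f := idfun) (fun m => ex_intro _ m erefl) ps u.
have /(tensor_right_exact ex ps)[y iy] :
    tensor_map idfun p (z - tensor_map k idfun v) = 0.
  by rewrite raddfB /= -tensor_swap pv ku subrr.
exists y; apply: (flat_quotient_pure (A := A') se Ff).
rewrite -tensor_swap iy raddfB /= fz tensor_map_comp0 ?subr0 // => a m.
by rewrite (exact_comp0 _ kf) tens0l.
Qed.

Section Product.
Variables (R : pzRingType) (M N : lmodType R).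

Lemma pair_linear (X : lmodType R) (f : {linear X -> M}) (g : {linear X -> N}) :
  exists h : {linear X -> (M * N)%type}, forall x, h x = (f x, g x).
Proof. by apply: linear_of => a x y; rewrite !linearP. Qed.

Lemma copair_linear (X : lmodType R) (f : {linear M -> X})
    (g : {linear N -> X}) :
  exists h : {linear (M * N)%type -> X}, forall x, h x = f x.1 + g x.2.
Proof.
apply: linear_of => a x y /=.
by rewrite !linearP scalerDr addrACA.
Qed.

Lemma proj1_linear : exists h : {linear (M * N)%type -> M}, h =1 fst.
Proof. exact: linear_of. Qed.
Lemma proj2_linear : exists h : {linear (M * N)%type -> N}, h =1 snd.
Proof. exact: linear_of. Qed.

Lemma projective_prod :
  projective_module M -> projective_module N -> projective_module (M * N)%type.
Proof.
move=> Mp Np X Y p f ps.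
have [i1 i1E] := pair_linear (X := M) idfun \0.
have [i2 i2E] := pair_linear (X := N) \0 idfun.
have [g1 g1E] := Mp _ _ p (f \o i1) ps.
have [g2 g2E] := Np _ _ p (f \o i2) ps.
have [g gE] := copair_linear g1 g2.
exists g => -[x y]; rewrite gE linearD g1E g2E /= -linearD i1E i2E /=.
by congr (f _); congr pair; rewrite ?addr0 ?add0r.
Qed.

Lemma flat_left_prod : flat_left M -> flat_left N -> flat_left (M * N)%type.
Proof.
move=> Mf Nf A A' A'' f g fg x.
split=> [gx|[y <-]]; last first.
  by apply: tensor_map_comp0 => a m; rewrite (exact_comp0 _ fg) tens0l.
have [i1 i1E] := pair_linear (X := M) idfun \0.
have [i2 i2E] := pair_linear (X := N) \0 idfun.
have [p1 p1E] := proj1_linear; have [p2 p2E] := proj2_linear.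
have /(Mf _ _ _ _ _ fg)[u fu] : tensor_map g idfun (tensor_map idfun p1 x) = 0.
  by rewrite tensor_swap gx raddf0.
have /(Nf _ _ _ _ _ fg)[v fv] : tensor_map g idfun (tensor_map idfun p2 x) = 0.
  by rewrite tensor_swap gx raddf0.
exists (tensor_map idfun i1 u + tensor_map idfun i2 v).
rewrite raddfD /= !tensor_swap fu fv.
pose id' := idfun : {linear A' -> A'}.
pose t1 := tensor_map id' i1 \o tensor_map id' p1.
pose t2 := tensor_map id' i2 \o tensor_map id' p2.
have := @tensor_ext _ _ _ _ (t1 \+ t2) idfun; apply=> a [m n].
rewrite /= !tensor_mapE -tensDr i1E i2E p1E p2E /=.
by congr (tens _ _); congr pair; rewrite ?addr0 ?add0r.
Qed.

End Product.

(** * Enough injective modules *)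

Definition divisible (D : zmodType) : Prop :=
  forall (y : D) (n : nat), exists x, x *+ n.+1 = y.

(** Every quotient of an abelian group [V] by a subgroup [S] embeds in a
divisible group.  The quotient is that of the free abelian group on [V] by the
relations that evaluate into [S], and dividing the rational vector space on [V]
by the same relations gives a divisible group that contains it. *)
Lemma divisible_hull (V : zmodType) (S : V -> Prop) :
  S 0 -> (forall x y, S x -> S y -> S (x - y)) ->
  exists (D : zmodType) (j : {additive V -> D}),
    divisible D /\ forall v, j v = 0 <-> S v.
Proof.
move=> S0 SB.
have [e eE] := @free_linear int V (ssrint.zmodule V) (fun v => v).
pose K (u : free_mod rat V) := exists w : free_mod int V,
  (forall x, fcoord x u = (fcoord x w)%:~R) /\ S (e w).
have K0 : K 0 by exists 0; split=> //; rewrite raddf0.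
have KB u u' : K u -> K u' -> K (u - u').
  move=> [w [uw Sw]] [w' [uw' Sw']]; exists (w - w').
  split=> [x|]; last by rewrite raddfB; apply: SB.
  by rewrite !fcoordB uw uw' rmorphB.
have [D [p [ps pK]]] := zmod_quotient K0 KB.
have jB : zmod_morphism (fun v : V => p (free_gen rat v)).
  move=> v v'; apply/eqP; rewrite -raddfB -subr_eq0 -raddfB; apply/eqP/pK.
  exists (free_gen int (v - v') - (free_gen int v - free_gen int v')); split.
    by move=> x; rewrite !fcoordB !fcoord_gen !rmorphB /= !mulrz_nat.
  rewrite !raddfB /= !eE [X in S X](_ : _ = 0) //.
  by rewrite -opprD; exact: subrr.
exists D, (HB.pack (fun v : V => p (free_gen rat v))
  (GRing.isZmodMorphism.Build _ _ _ jB) : {additive V -> D}).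
split=> [y n|v /=].
  have [u <-] := ps y; exists (p ((n.+1%:R : rat)^-1 *: u)).
  by rewrite -raddfMn -scaler_nat scalerA divff ?scale1r ?pnatr_eq0.
rewrite pK; split=> [[w [gw Sw]]|Sv].
  suff /esym vE : e (free_gen int v) = e w by rewrite vE eE in Sw.
  congr (e _); apply: fcoordP => x; apply: (@intr_inj rat).
  by rewrite -gw !fcoord_gen mulrz_nat.
by exists (free_gen int v); split=> [x|]; rewrite ?eE // !fcoord_gen mulrz_nat.
Qed.

Section Extension.
Local Open Scope classical_set_scope.
Variables (N D : zmodType) (Ddiv : divisible D).

Lemma pairB (a a' : N) (b b' : D) : (a, b) - (a', b') = (a - a', b - b').
Proof. by []. Qed.

(** The graph of a homomorphism defined on a subgroup of [N]. *)
Definition partial_hom (G : set (N * D)) : Prop :=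
  [/\ G 0, forall p q, G p -> G q -> G (p - q) & forall d, G (0, d) -> d = 0].

Lemma partial_homMz (G : set (N * D)) (x : N) (y : D) (m : int) :
  partial_hom G -> G (x, y) -> G (x *~ m, y *~ m).
Proof.
move=> [G0 GB _] Gxy.
have GN p : G p -> G (- p) by rewrite -sub0r; apply: GB.
have GM n : G (x *+ n, y *+ n).
  elim: n => [|n IH]; first by rewrite !mulr0n.
  by rewrite !mulrSr; have := GB _ _ IH (GN _ Gxy); rewrite opprK.
case: m => n; first exact: GM.
by rewrite !NegzE !mulrNz; apply: (GN (_, _)); apply: GM.
Qed.

(** The integers [m] with [x *~ m] in the domain of [G] are the multiples of
some [k].  If [k] is positive, the value [y] at [x] has to satisfy
[G (x *~ k, y *~ k)], which divisibility allows; if [k = 0], any value will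
do. *)
Lemma partial_hom_extend (G : set (N * D)) (x : N) :
  partial_hom G ->
  exists2 G', partial_hom G' & G `<=` G' /\ exists y, G' (x, y).
Proof.
move=> Gh; have [G0 GB Gf] := Gh.
have [y yP] : exists y, forall (m : int) d, G (x *~ m, d) -> d = y *~ m.
  have [[k0 [d0 Gk0]]|no] := pselect (exists k d, G (x *+ k.+1, d)).
    have exk : exists k, `[< exists d, G (x *+ k.+1, d) >].
      by exists k0; apply/asboolP; exists d0.
    (* k.+1 is the least positive multiplier taking x into the domain. *)
    have := ex_minnP exk => -[k /asboolP[d Gk] kmin].
    have [y yd] := Ddiv d k; exists y => m b Gm.
    pose q := (m %/ k.+1)%Z; pose r := (m %% k.+1)%Z.
    have mE : m = k.+1%:Z * q + r by rewrite mulrC; apply: divz_eq.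
    have Gr : G (x *~ r, b - y *~ (k.+1%:Z * q)).
      have := GB _ _ Gm (partial_homMz q Gh Gk).
      rewrite -yd !pmulrn -!mulrzA pairB.
      by rewrite -mulrzBr {1}mE addrAC subrr add0r.
    have r0 : r = 0.
      have : (0 <= r)%R by apply: modz_ge0.
      have : (r < k.+1%:Z)%R by apply: ltz_pmod.
      case: r Gr {mE} => // -[//|n] Gr nk _.
      have /kmin : `[< exists d, G (x *+ n.+1, d) >].
        by apply/asboolP; eexists; exact: Gr.
      by rewrite leqNgt; move: nk; rewrite ltz_nat ltnS => ->.
    rewrite mE r0 addr0; apply/eqP; rewrite -subr_eq0; apply/eqP/Gf.
    by move: Gr; rewrite r0 mulr0z.
  exists 0 => m d Gm; rewrite mul0rz.
  case: m Gm => [[|n]|n] Gm; first exact: Gf.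
    by case: no; exists n, d.
  case: no; exists n, (- d); have := GB (0, 0) _ G0 Gm.
  by rewrite pairB !sub0r NegzE mulrNz opprK.
exists [set p | exists m : int, G (p.1 - x *~ m, p.2 - y *~ m)].
  split=> [|[a b] [a' b'] [m Gm] [m' Gm']|d [m]] /=.
  - by exists 0; rewrite !mulr0z !subr0.
  - exists (m - m'); have := GB _ _ Gm Gm'; rewrite !mulrzBr /=.
    congr G; congr pair => /=; by rewrite opprD addrACA -opprD.
  - rewrite /= sub0r -mulrNz => /yP; rewrite mulrNz => /eqP.
    by rewrite -subr_eq0 opprK subrK => /eqP.
split=> [[a b] Gab|]; first by exists 0; rewrite !mulr0z !subr0.
by exists y; exists 1; rewrite !mulr1z !subrr.
Qed.

(** Divisible groups are injective, by Zorn's lemma applied to graphs of partial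
homomorphisms that extend [f] along [i]. *)
Lemma additive_extend (M : zmodType) (i : {additive M -> N})
    (f : {additive M -> D}) :
  injective i -> exists g : {additive N -> D}, forall x, g (i x) = f x.
Proof.
move=> ii; pose base : set (N * D) := [set p | exists m, p = (i m, f m)].
have base_hom : partial_hom base.
  split=> [|_ _ [m ->] [m' ->]|d [m [im ->]]].
  - by exists 0; rewrite !raddf0.
  - by exists (m - m'); rewrite !raddfB.
  - by rewrite (_ : m = 0) ?raddf0 //; apply: inj_eq0 ii _.
(* The base graph is adjoined to every member since the chain may be empty. *)
have [|A [Ah Amax]] := @Zorn_bigcup _ (fun G => partial_hom (G `|` base)).
  move=> F Fh Ftot.
  have com p q : (\bigcup_(X in F) X `|` base) p ->
      (\bigcup_(X in F) X `|` base) q ->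
      exists W,
        [/\ partial_hom W, W `<=` \bigcup_(X in F) X `|` base, W p & W q].
    have sub X : F X -> X `|` base `<=` \bigcup_(X in F) X `|` base.
      by move=> FX; apply: setSU; apply: bigcup_sup.
    case=> [[X FX Xp]|bp]; case=> [[Y FY Yq]|bq].
    - have [XY|YX] := Ftot X Y FX FY.
        exists (Y `|` base).
        by split; [apply: Fh|apply: sub|left; apply: XY|left].
      exists (X `|` base).
      by split; [apply: Fh|apply: sub|left|left; apply: YX].
    - by exists (X `|` base); split; [apply: Fh|apply: sub|left|right].
    - by exists (Y `|` base); split; [apply: Fh|apply: sub|right|left].
    - by exists base; split=> //; right.
  split=> [|p q Up Uq|d Ud].
  - by right; case: base_hom.
  - by have [W [[_ WB _] WU Wp Wq]] := com p q Up Uq; apply: WU; apply: WB.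
  - by have [W [[_ _ Wf] WU Wp _]] := com _ _ Ud Ud; apply: Wf.
have [G0 GB Gf] := Ah.
have tot x : exists y, (A `|` base) (x, y).
  have [G' G'h [AG' [y Gxy]]] := partial_hom_extend x Ah.
  have [[z Az]|no] := pselect (exists z, (A `|` base) (x, z)).
    by exists z.
  have bG' : G' `|` base = G'.
    by apply/setUidPl; apply: subset_trans AG'; right.
  case: (Amax G'); last by rewrite bG'.
  split; first by apply: subset_trans AG'; left.
  by move=> /(_ _ Gxy) Axy; case: no; exists y; left.
have [g gP] := choice tot.
have g_uniq x y : (A `|` base) (x, y) -> y = g x.
  move=> Axy; apply/eqP; rewrite -subr_eq0; apply/eqP/Gf.
  by have := GB _ _ Axy (gP x); rewrite pairB subrr.
have gB : zmod_morphism g.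
  by move=> x y; apply/esym/g_uniq; apply: (GB _ _ (gP x) (gP y)).
exists (HB.pack g (GRing.isZmodMorphism.Build _ _ _ gB) : {additive N -> D}).
move=> x /=.
by apply/esym/g_uniq; right; exists x.
Qed.

End Extension.

(** The coinduced module of additive maps R -> D, on which R acts by right
translation of the argument. *)
Section Coinduced.
Variables (R : pzRingType) (D : zmodType).

Definition additive_pred : pred (R -> D) := fun f => `[< zmod_morphism f >].

Lemma additive_zmod_closed : zmod_closed additive_pred.
Proof.
split=> [|f g /asboolP fB /asboolP gB]; apply/asboolP => x y /=.
  by rewrite [RHS]subrr.
have E z : (f - g) z = f z - g z by [].
by rewrite !E fB gB opprD addrACA -opprD.
Qed.

HB.instance Definition _ :=
  GRing.isZmodClosed.Build (R -> D) additive_pred additive_zmod_closed.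

Record coind : Type :=
  Coind { coind_val : R -> D; _ : coind_val \in additive_pred }.

HB.instance Definition _ := [isSub for coind_val].
HB.instance Definition _ := [Choice of coind by <:].
HB.instance Definition _ := [SubChoice_isSubZmodule of coind by <:].

Lemma coind_valB (f : coind) x y :
  coind_val f (x - y) = coind_val f x - coind_val f y.
Proof. by have /asboolP := valP f; apply. Qed.

Lemma coind_valD (f : coind) x y :
  coind_val f (x + y) = coind_val f x + coind_val f y.
Proof.
have f0 : coind_val f 0 = 0 by have := coind_valB f 0 0; rewrite !subrr.
by rewrite -[y in LHS]opprK coind_valB -(sub0r y) coind_valB f0 sub0r opprK.
Qed.

Lemma coindP (f g : coind) : coind_val f =1 coind_val g -> f = g.
Proof. by move=> fg; apply: val_inj; apply: funext. Qed.

Lemma coind_scale_subproof (r : R) (f : coind) :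
  (fun x => coind_val f (x * r)) \in additive_pred.
Proof. by apply/asboolP => x y; rewrite mulrBl coind_valB. Qed.

Definition coind_scale r f := Coind (coind_scale_subproof r f).

Lemma coind_scaleA a b f :
  coind_scale a (coind_scale b f) = coind_scale (a * b) f.
Proof. by apply: coindP => x /=; rewrite mulrA. Qed.
Lemma coind_scale1 : left_id 1 coind_scale.
Proof. by move=> f; apply: coindP => x /=; rewrite mulr1. Qed.
Lemma coind_scaleDr : right_distributive coind_scale +%R.
Proof. by move=> a f g; apply: coindP. Qed.
Lemma coind_scaleDl f : {morph coind_scale^~ f : a b / a + b}.
Proof. by move=> a b; apply: coindP => x /=; rewrite mulrDr coind_valD. Qed.

HB.instance Definition _ := GRing.Zmodule_isLmodule.Build R coind
  coind_scaleA coind_scale1 coind_scaleDr coind_scaleDl.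

(** Half of the adjunction between restriction of scalars to the integers and
coinduction; the other half is evaluation at [1]. *)
Lemma coind_transpose (M : lmodType R) (g : {additive M -> D}) :
  exists h : {linear M -> coind}, forall m r, coind_val (h m) r = g (r *: m).
Proof.
have sub m : (fun r => g (r *: m)) \in additive_pred.
  by apply/asboolP => x y; rewrite scalerBl raddfB.
have [|h hE] := @linear_of R M coind (fun m => Coind (sub m)); last first.
  by exists h => m r; rewrite hE.
move=> a m n; apply: coindP => r.
have E (u v : coind) :
  coind_val (a *: u + v) r = coind_val u (r * a) + coind_val v r by [].
by rewrite E /= scalerDr scalerA raddfD.
Qed.

(** Coinduction is right adjoint to an exact functor, so it preserves injective
objects. *)
Lemma coind_injective : divisible D -> injective_module coind.
Proof.
move=> Dd M N i f ii.
have evB : zmod_morphism (fun m => coind_val (f m) 1).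
  by move=> x y; rewrite raddfB.
pose ev : {additive M -> D} := HB.pack (fun m => coind_val (f m) 1)
  (GRing.isZmodMorphism.Build _ _ _ evB).
have [g gE] := additive_extend Dd ev ii.
have [h hE] := coind_transpose g.
exists h => m; apply: coindP => r; rewrite hE -linearZ gE /ev /= linearZ /=.
by rewrite mul1r.
Qed.

End Coinduced.

(** This plays the part of embedding the cokernel of [f] in an injective module,
without a quotient module: only the quotient group of [N] by the image is
embedded, in a divisible group [D].  An element of [N] is killed by the induced
map into the coinduced module when all its multiples lie in the image of [f],
that is, when it lies there itself. *)
Lemma exact_to_injective (R : pzRingType) (M N : lmodType R)
    (f : {linear M -> N}) :
  exists (E : lmodType R) (g : {linear N -> E}),
    injective_module E /\ exact_at f g.
Proof.
have [|x y [m <-] [m' <-]|D [j [Dd jE]]] :=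
  @divisible_hull N (fun y => exists x, f x = y).
- by exists 0; rewrite raddf0.
- by exists (m - m'); rewrite raddfB.
have [h hE] := coind_transpose (M := N) j.
exists (coind R D), h; split; first exact: coind_injective.
move=> y; split=> [hy|/[dup] [[x <-]] _].
  by apply/jE; rewrite -[y]scale1r -hE hy.
apply: coindP => r; rewrite hE; apply/jE.
by exists (r *: x); rewrite linearZ.
Qed.

(** * Finite resolutions *)

Lemma flat_zero_module (R : pzRingType) :
  exists Z : lmodType R, (forall x : Z, x = 0) /\ flat_left Z.
Proof.
exists (free_mod R void); split=> [x|]; last exact: free_flat_left.
by apply: fcoordP => -[].
Qed.

(** Resolutions of length [n], by recursion on the first syzygy rather than as
sequences indexed by all natural numbers; it is the form that inductions on the
length need. *)
Fixpoint resolved (R : pzRingType) (X : lmodType R -> Prop) (n : nat)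
    (M : lmodType R) : Prop :=
  match n with
  | 0%N => X M
  | n'.+1 =>
      exists (K P : lmodType R) (i : {linear K -> P}) (p : {linear P -> M}),
      [/\ X P, resolved X n' K & short_exact i p]
  end.

Lemma resolved_of_resolution (R : pzRingType) (X : lmodType R -> Prop) :
  (forall (M N : lmodType R) (f : {linear M -> N}),
     injective f -> onto f -> X M -> X N) ->
  forall n M, has_resolution X M n -> resolved X n M.
Proof.
move=> Xiso; elim=> [|n IH] M [G [d [e [GX G0 dex eex es]]]] /=.
  apply: (Xiso _ _ e) => //; last exact: GX.
  apply: raddf_inj => x /eex[u <-].
  by rewrite (G0 1%N _ u) // raddf0.
have [i [ii iex]] := ker_incl e.
have [e' e'E] := mono_lift (h := d 0%N) ii iex (fun x => exact_comp0 x eex).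
exists (ker_mod e), (G 0%N), i, e; split=> //; first exact: GX.
apply: IH; exists (fun j => G j.+1), (fun j => d j.+1), e'.
split=> [j jn|j nj x|j|x|y].
- exact: GX.
- exact: G0.
- exact: dex.
- rewrite -dex -e'E; split=> [->|/(inj_eq0 ii)]; rewrite ?raddf0 //.
- have /eex[x dx] := exact_comp0 y iex.
  by exists x; apply: ii; rewrite e'E.
Qed.

Lemma resolution_of_resolved (R : pzRingType) (X : lmodType R -> Prop) n M :
  resolved X n M -> has_resolution X M n.
Proof.
elim: n M => [|n IH] M /=.
  move=> XM; have [Z [Z0 _]] := flat_zero_module R.
  exists (fun j => if j is 0%N then M else Z), (fun j => \0), idfun.
  split=> [[|j] //|[//|j] _ x|j x|x|m].
  - exact: Z0.
  - by split=> // _; exists 0; rewrite (Z0 x) raddf0.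
  - by split=> [/= ->|[u <-]] //; exists 0.
  - by exists m.
move=> [K [P [i [p [XP /IH[G [d [e [GX G0 dex eex es]]]] [ii iex ps]]]]]].
pose G' j := if j is j'.+1 then G j' else P.
pose d' j : {linear G' j.+1 -> G' j} :=
  match j return {linear G' j.+1 -> G' j} with
  | 0%N => i \o e
  | j'.+1 => d j'
  end.
exists G', d', p; split=> [[|j] // jn|[//|j] nj x|[|j] //= x|x|//].
- exact: GX.
- exact: (G0 _ nj).
- by rewrite -eex /=; split=> [/(inj_eq0 ii)|ex0] //; rewrite ex0 raddf0.
- rewrite iex; split=> [[u <-]|[u <-]]; last by exists (e u).
  by have [v <-] := es u; exists v.
Qed.

(** * Flat dimension of syzygies *)

Section FlatDimension.
Variable R : pzRingType.
Implicit Types M N P F : lmodType R.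

Lemma resolved_flatS n M :
  resolved (@flat_left R) n M -> resolved (@flat_left R) n.+1 M.
Proof.
elim: n M => [|n IH] M.
  move=> Mf; have [Z [Z0 Zf]] := flat_zero_module R.
  exists Z, M, \0, idfun; split=> //; split=> [x y _|x|y]; last by exists y.
    by rewrite (Z0 x) (Z0 y).
  by split=> [/= ->|[u <-]] //; exists 0.
by move=> [K [P [i [p [Pf /IH Kf ex]]]]]; exists K, P, i, p.
Qed.

Lemma resolved_flat_leq m n M : (m <= n)%N ->
  resolved (@flat_left R) m M -> resolved (@flat_left R) n M.
Proof.
move=> /subnK <-; elim: (n - m)%N => [|k IH] // /IH; exact: resolved_flatS.
Qed.

(** With [Q] the first flat module of a resolution of [Z], the kernel of
[Q -> Z -> F] is flat, and it covers [L] with the same syzygy as [Q -> Z]. *)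
Lemma resolved_flat_kernel n (L Z F : lmodType R) (i : {linear L -> Z})
    (p : {linear Z -> F}) :
  short_exact i p -> flat_left F -> resolved (@flat_left R) n Z ->
  resolved (@flat_left R) n L.
Proof.
case: n => [|n] se Ff; first by move=> Zf; apply: flat_left_kernel se Zf Ff.
have [ii iex ps] := se.
move=> [K [Q [j [q [Qf Kf [ji jex qs]]]]]].
have [k [ki kex]] := ker_incl (p \o q).
have [r rE] := mono_lift (h := q \o k) ii iex (fun x => exact_comp0 x kex).
have pqj x : (p \o q) (j x) = 0 by rewrite /= (exact_comp0 _ jex) raddf0.
have [j' j'E] := mono_lift ki kex pqj.
exists K, (ker_mod (p \o q)), j', r; split=> //.
  apply: (@flat_left_kernel _ _ _ _ k (p \o q)) => //; split=> // y.
  have [z <-] := ps y; have [x <-] := qs z; by exists x.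
split=> [x y /(congr1 k)|y|l].
- by rewrite !j'E => /ji.
- split=> [ry|[x <-]]; last first.
    by apply: ii; rewrite rE /= j'E (exact_comp0 _ jex) raddf0.
  have /jex[x jx] : q (k y) = 0 by rewrite -[LHS]rE ry raddf0.
  by exists x; apply: ki; rewrite j'E.
- have [x qx] := qs (i l).
  have /kex[y ky] : (p \o q) x = 0 by rewrite /= qx (exact_comp0 _ iex).
  by exists y; apply: ii; rewrite rE /= ky.
Qed.

Lemma resolved_flat_prod n M P :
  resolved (@flat_left R) n M -> flat_left P ->
  resolved (@flat_left R) n (M * P)%type.
Proof.
case: n => [|n]; first exact: flat_left_prod.
move=> [K [F [i [p [Ff Kf [ii iex ps]]]]]] Pf.
have [p1 p1E] := proj1_linear F P; have [p2 p2E] := proj2_linear F P.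
have [j jE] := pair_linear i (\0 : {linear K -> P}).
have [q qE] := pair_linear (p \o p1) p2.
exists K, (F * P)%type, j, q; split=> //; first exact: flat_left_prod.
split=> [x y|[x y]|[x y]].
- by rewrite !jE => -[/ii].
- rewrite qE /= p1E p2E /=; split=> [[/iex[k <-] ->]|[k]].
    by exists k; rewrite jE.
  by rewrite jE => -[<- <-]; rewrite (exact_comp0 _ iex).
- by have [z <-] := ps x; exists (z, y); rewrite qE /= p1E p2E.
Qed.

(** Schanuel's lemma.  Let [F] cover [M] with syzygy [K] of flat dimension at
most [n].  Lifting [p] to [s : P -> F] gives an epimorphism [K * P -> F] whose
kernel is the kernel of [p], so that [resolved_flat_kernel] applies. *)
Lemma resolved_flat_syzygy n M P (p : {linear P -> M}) :
  projective_module P -> onto p ->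
  resolved (@flat_left R) n.+1 M -> resolved (@flat_left R) n (ker_mod p).
Proof.
move=> Pp ps [K [F [i [q [Ff Kf [ii iex qs]]]]]].
have [u [ui uex]] := ker_incl p.
have [s sE] := Pp _ _ q p qs.
have [|t tE] := mono_lift (h := \- (s \o u)) ii iex.
  by move=> x; rewrite /= linearN sE (exact_comp0 _ uex) oppr0.
have [j jE] := pair_linear t u; have [c cE] := copair_linear i s.
apply: (@resolved_flat_kernel _ _ _ _ j c) Ff _; last first.
  by apply: resolved_flat_prod => //; apply: projective_flat.
split=> [x y|[k x]|y].
- by rewrite !jE => -[_ /ui].
- rewrite cE /=; split=> [e0|[z]]; last first.
    by rewrite jE => -[<- <-]; rewrite tE /= addNr.
  have /uex[z uz] : p x = 0.
    rewrite -sE -[s x](addKr (i k)) e0 addr0 linearN.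
    by rewrite (exact_comp0 _ iex) oppr0.
  exists z; rewrite jE uz; congr pair; apply: ii; rewrite tE /= uz.
  by apply/eqP; rewrite eq_sym -addr_eq0 e0.
- have [x px] := ps (q y).
  have /iex[k ik] : q (y - s x) = 0 by rewrite linearB sE px subrr.
  by exists (k, x); rewrite cE /= ik subrK.
Qed.

End FlatDimension.

(** * Injective and projective resolutions *)

Definition coresolved (R : pzRingType) (X : lmodType R -> Prop)
    (M : lmodType R) : Prop :=
  exists (C : nat -> lmodType R) (d : forall j, {linear C j -> C j.+1})
    (e : {linear M -> C 0%N}),
    [/\ forall j, X (C j), injective e, exact_at e (d 0%N) &
        forall j, exact_at (d j) (d j.+1)].

(** The state of the recursions that build resolutions: the last differential
constructed so far. *)
Record module_map (R : pzRingType) := ModuleMap {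
  map_dom : lmodType R;
  map_cod : lmodType R;
  map_fun : {linear map_dom -> map_cod} }.

Lemma enough_injectives (R : pzRingType) (M : lmodType R) :
  coresolved (@injective_module R) M.
Proof.
have step (a : module_map R) :
    exists b : {E : lmodType R & {linear map_cod a -> E}},
    injective_module (projT1 b) /\ exact_at (map_fun a) (projT2 b).
  have [E [g gP]] := exact_to_injective (map_fun a).
  by exists (existT (fun E : lmodType R => {linear map_cod a -> E}) E g).
have [nx nxP] := dep_choice step.
have [E [e [Einj eex]]] := exact_to_injective (\0 : {linear M -> M}).
pose s j := iter j (fun a => ModuleMap (projT2 (nx a))) (ModuleMap e).
exists (fun j => map_cod (s j)), (fun j => map_fun (s j.+1)), e.
split=> [[|j]||//|j] //=.
- by case: (nxP (s j)).
- by apply: raddf_inj => x /eex[y <-].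
- by case: (nxP (s 0%N)).
- by case: (nxP (s j.+1)).
Qed.

Lemma exact_from_projective (R : pzRingType) (M N : lmodType R)
    (f : {linear M -> N}) :
  exists (P : lmodType R) (p : {linear P -> M}),
    projective_module P /\ exact_at p f.
Proof.
have [i [ii iex]] := ker_incl f; have [q qs] := free_cover (ker_mod f).
exists (free_mod R (ker_mod f)), (i \o q); split; first exact: free_projective.
move=> x; rewrite iex; split=> [[y <-]|[u <-]]; last by exists (q u).
by have [v <-] := qs y; exists v.
Qed.

Lemma enough_projectives (R : pzRingType) (M : lmodType R) :
  exists (P : nat -> lmodType R) (d : forall j, {linear P j.+1 -> P j})
    (e : {linear P 0%N -> M}),
    [/\ forall j, projective_module (P j), onto e, exact_at (d 0%N) e &
        forall j, exact_at (d j.+1) (d j)].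
Proof.
have step (a : module_map R) :
    exists b : {P : lmodType R & {linear P -> map_dom a}},
    projective_module (projT1 b) /\ exact_at (projT2 b) (map_fun a).
  have [P [g gP]] := exact_from_projective (map_fun a).
  by exists (existT (fun P : lmodType R => {linear P -> map_dom a}) P g).
have [nx nxP] := dep_choice step.
have [P [e [Pp eex]]] := exact_from_projective (\0 : {linear M -> M}).
pose s j := iter j (fun a => ModuleMap (projT2 (nx a))) (ModuleMap e).
exists (fun j => map_dom (s j)), (fun j => map_fun (s j.+1)), e.
split=> [[|j]|y||j] //=.
- by case: (nxP (s j)).
- by apply/eex.
- by case: (nxP (s 0%N)).
- by case: (nxP (s j.+1)).
Qed.

(** * The syzygy of a coresolution *)

(** The horseshoe lemma along a coresolution [C] of [M].  Let [q j : P j -> C j]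
cover the kernel of [d j], and lift [q j.+1] to [l j : P j.+1 -> C j] with
[d j (l j x) = q j.+1 x].  Then [s j (x, y) = q j x + l j y] is an epimorphism
[P j * P j.+1 -> C j], and the maps (x, y) |-> (y, 0) between the kernels of the
[s j] form a coresolution of the kernel of [P 0 -> M]. *)
Lemma coresolved_syzygy (R : pzRingType) n (M : lmodType R) :
  coresolved (resolved (@flat_left R) n.+1) M ->
  exists (P : lmodType R) (p : {linear P -> M}),
    [/\ flat_left P, onto p &
        coresolved (resolved (@flat_left R) n) (ker_mod p)].
Proof.
move=> [C [d [e [CX ei eex dex]]]].
have /dep_choice[P /dep_choice[q qP]] := fun j => exact_from_projective (d j).
have Pp j : projective_module (P j) by case: (qP j).
have qex j : exact_at (q j) (d j) by case: (qP j).
have /dep_choice[l lE] : forall j, exists l : {linear P j.+1 -> C j},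
    forall x, d j (l x) = q j.+1 x.
  move=> j; have [k [ki kex]] := ker_incl (d j.+1).
  have [dj djE] := mono_lift (h := d j) ki kex (fun x => exact_comp0 x (dex j)).
  have [qj qjE] := mono_lift (h := q j.+1) ki kex
    (fun x => exact_comp0 x (qex j.+1)).
  have djs : onto dj.
    move=> y; have /dex[x dx] := exact_comp0 y kex.
    by exists x; apply: ki; rewrite djE.
  have [l lE] := Pp j.+1 _ _ dj qj djs.
  by exists l => x; rewrite -djE lE qjE.
have /dep_choice[s sE] := fun j => copair_linear (q j) (l j).
have ss j : onto (s j).
  move=> x; have /qex[y qy] : d j.+1 (d j x) = 0 by apply: exact_comp0.
  have /qex[z qz] : d j (x - l j y) = 0 by rewrite linearB lE qy subrr.
  by exists (z, y); rewrite sE /= qz subrK.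
have /dep_choice[u uP] := fun j => ker_incl (s j).
have ui j : injective (u j) by case: (uP j).
have uex j : exact_at (u j) (s j) by case: (uP j).
have [p pE] := mono_lift (h := q 0%N) ei eex (fun x => exact_comp0 x (qex 0%N)).
have ps : onto p.
  move=> m; have /qex[x qx] := exact_comp0 m eex.
  by exists x; apply: ei; rewrite pE.
have [k [ki kex]] := ker_incl p.
have /dep_choice[d' d'E] : forall j,
    exists d' : {linear ker_mod (s j) -> ker_mod (s j.+1)},
    forall x, u j.+1 (d' x) = ((u j x).2, 0).
  move=> j; have [pr prE] := proj2_linear (P j) (P j.+1).
  have [h hE] := pair_linear (pr \o u j) (\0 : {linear _ -> P j.+2}).
  have [|g gE] := mono_lift (h := h) (ui j.+1) (uex j.+1).
    move=> x; rewrite hE sE /= linear0 addr0 prE -lE.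
    have := exact_comp0 x (uex j); rewrite sE => /(congr1 (d j)).
    by rewrite linearD linear0 (exact_comp0 _ (qex j)) add0r.
  by exists g => x; rewrite gE hE /= prE.
have [e' e'E] : exists e' : {linear ker_mod p -> ker_mod (s 0%N)},
    forall x, u 0%N (e' x) = (k x, 0).
  have [h hE] := pair_linear k (\0 : {linear _ -> P 1%N}).
  have [|g gE] := mono_lift (h := h) (ui 0%N) (uex 0%N).
    by move=> x; rewrite hE sE /= linear0 addr0 -pE (exact_comp0 _ kex) raddf0.
  by exists g => x; rewrite gE hE.
exists (P 0%N), p; split=> //; first exact: projective_flat.
exists (fun j => ker_mod (s j)), d', e'; split=> [j|x y|y|j y].
- by apply: (resolved_flat_syzygy _ (ss j) (CX j)); apply: projective_prod.
- move=> exy; have : u 0%N (e' x) = u 0%N (e' y) by rewrite exy.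
  by rewrite !e'E => -[/ki].
- split=> [dy|[x <-]]; last by apply: ui; rewrite d'E e'E raddf0.
  have y2 : (u 0%N y).2 = 0 by have := d'E 0%N y; rewrite dy raddf0 => -[].
  have /kex[x kx] : p (u 0%N y).1 = 0.
    apply: (inj_eq0 ei); rewrite /= pE.
    by have := exact_comp0 y (uex 0%N); rewrite sE y2 linear0 addr0.
  by exists x; apply: ui; rewrite e'E kx -y2; case: (u 0%N y).
- split=> [dy|[x <-]]; last by apply: ui; rewrite !d'E raddf0.
  have y2 : (u j.+1 y).2 = 0 by have := d'E j.+1 y; rewrite dy raddf0 => -[].
  have qy : q j.+1 (u j.+1 y).1 = 0.
    by have := exact_comp0 y (uex j.+1); rewrite sE y2 linear0 addr0.
  (* Write u y = (y1, 0).  The preimage is (- z, y1) with q j z = l j y1, and z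
     exists because d j (l j y1) = q j.+1 y1 = 0. *)
  have /qex[z qz] : d j (l j (u j.+1 y).1) = 0 by rewrite lE.
  have /uex[x ux] : s j (- z, (u j.+1 y).1) = 0.
    by rewrite sE /= linearN qz addNr.
  by exists x; apply: ui; rewrite d'E ux /= -y2; case: (u j.+1 y).
Qed.

(** * Tensoring an exact complex of flat modules *)

(** [g] continues to the right as an exact sequence of flat modules, for [m]
more steps.  Stating this for a single map lets one lemma cover the three kinds
of differential of a two-sided complex. *)
Fixpoint flat_tail (R : pzRingType) (m : nat) (U V : lmodType R)
    (g : {linear U -> V}) : Prop :=
  flat_left V /\
  match m with
  | 0%N => True
  | m'.+1 =>
      exists (W : lmodType R) (h : {linear V -> W}),
      exact_at g h /\ flat_tail m' h
  end.

Lemma flat_tail_flat (R : pzRingType) m (U V : lmodType R)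
    (g : {linear U -> V}) :
  flat_tail m g -> flat_left V.
Proof. by case: m => [|m] []. Qed.

(** Dimension shifting.  In the short exact sequence of complexes obtained from
0 -> K -> Q -> A -> 0, a cycle of the third complex lifts to the second, and the
differential of the lift is a cycle [z] of the first, one step to the right,
where the induction hypothesis makes it a boundary.  Each step of the resolution
of [A] therefore uses up one step of the sequence of flat modules. *)
Lemma tensor_flat_exact (R : pzRingType) (m : nat) (A : lmodType R^c) :
  resolved (@flat_right R) m A ->
  forall (U V W : lmodType R) (f : {linear U -> V}) (g : {linear V -> W}),
  exact_at f g -> flat_left U -> flat_left V -> flat_tail m g ->
  exact_at (tensor_map (idfun : {linear A -> A}) f)
           (tensor_map (idfun : {linear A -> A}) g).
Proof.
elim: m A => [|m IH] A; first by move=> Af U V W f g fg _ _ _; apply: Af.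
move=> [K [Q [i [p [Qf Kf [ii iex ps]]]]]] U V W f g fg Uf Vf.
move=> [Wf [T [h [gh hT]]]] x.
split=> [gx|[y <-]]; last first.
  by apply: tensor_map_comp0 => a n; rewrite (exact_comp0 _ fg) tens0r.
have [y py] := tensor_map_surj ps (g := idfun) (fun n => ex_intro _ n erefl) x.
have /(Wf _ _ _ _ _ iex)[z iz] : tensor_map p idfun (tensor_map idfun g y) = 0.
  by rewrite tensor_swap py.
have /(IH K Kf _ _ _ _ _ gh Vf Wf hT)[w gw] : tensor_map idfun h z = 0.
  apply: (flat_left_inj (flat_tail_flat hT) ii); rewrite tensor_swap iz raddf0.
  by apply: tensor_map_comp0 => a n; rewrite (exact_comp0 _ gh) tens0r.
have /(Qf _ _ _ _ _ fg)[u fu] :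
    tensor_map idfun g (y - tensor_map i idfun w) = 0.
  by rewrite raddfB /= -tensor_swap gw iz subrr.
exists (tensor_map p idfun u); rewrite -tensor_swap fu raddfB /= py.
rewrite tensor_map_comp0 ?subr0 // => a n.
by rewrite (exact_comp0 _ iex) tens0l.
Qed.

(** * Gorenstein flat syzygies *)

Definition finite_flat_dim (R : pzRingType) (B : lmodType R^c -> Prop) : Prop :=
  forall A, B A -> exists m, resolved (@flat_right R) m A.

(** The complex is a projective resolution of [M] followed by the given
coresolution.  Each of its differentials has arbitrarily long flat tails. *)
Lemma gorenstein_flat_of_coresolved (R : pzRingType)
    (B : lmodType R^c -> Prop) (M : lmodType R) :
  finite_flat_dim B -> coresolved (@flat_left R) M -> gorenstein_flat B M.
Proof.
move=> Bfin [C [d [e [Cf ei eex dex]]]].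
have [P [b [a [Pp as_ aex bex]]]] := enough_projectives M.
have Pf j : flat_left (P j) by apply: projective_flat.
have mid_ex : exact_at (e \o a) (d 0%N).
  move=> x; rewrite eex; split=> [[m <-]|[y <-]]; last by exists (a y).
  by have [y <-] := as_ m; exists y.
have lo_ex : exact_at (b 0%N) (e \o a).
  move=> x; rewrite -aex; split=> [/(inj_eq0 ei)|/= ->] //; exact: raddf0.
have upT m j : flat_tail m (d j).
  elim: m j => [|m IH] j; split=> //.
  by exists (C j.+2), (d j.+1).
have midT m : flat_tail m (e \o a).
  by case: m => [|m]; split=> //; exists (C 1%N), (d 0%N).
have loT m j : flat_tail m (b j).
  elim: m j => [|m IH] [|j]; split=> //; first by exists (C 0%N), (e \o a).
  by exists (P j), (b j).
exists (Biseq b (e \o a) d); split=> //.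
  move=> A /Bfin[m Am].
  split=> [j||| j]; apply: (tensor_flat_exact Am) => //=.
have [k [ki kex]] := ker_incl (d 0%N).
have [g gE] := mono_lift (h := e) ki kex (fun x => exact_comp0 x eex).
have [|x|g' [gK g'K]] := linear_inverse (f := g).
- by move=> x y /(congr1 k); rewrite !gE => /ei.
- have /eex[m em] := exact_comp0 x kex.
  by exists m; apply: ki; rewrite gE.
by exists g, g'.
Qed.

(** A flat module [P] is its own coresolution, P -> P -> 0 -> 0 -> ... *)
Lemma flat_gorenstein_flat (R : pzRingType) (B : lmodType R^c -> Prop)
    (P : lmodType R) :
  finite_flat_dim B -> flat_left P -> gorenstein_flat B P.
Proof.
move=> Bfin Pf; apply: gorenstein_flat_of_coresolved => //.
have [Z [Z0 Zf]] := flat_zero_module R.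
exists (fun j => if j is 0%N then P else Z), (fun j => \0), idfun.
split=> [[|j]||x|j x] //.
- by split=> // _; exists x.
- by split=> // _; exists 0; rewrite (Z0 x) raddf0.
Qed.

Lemma resolved_gorenstein_flat (R : pzRingType) (B : lmodType R^c -> Prop) n
    (M : lmodType R) :
  finite_flat_dim B -> coresolved (resolved (@flat_left R) n) M ->
  resolved (gorenstein_flat B) n M.
Proof.
move=> Bfin; elim: n M => [|n IH] M; first exact: gorenstein_flat_of_coresolved.
move=> /coresolved_syzygy[P [p [Pf ps /IH Kg]]].
have [k [ki kex]] := ker_incl p.
exists (ker_mod p), P, k, p; split=> //; exact: flat_gorenstein_flat.
Qed.

Theorem proposition3p7 (R : pzRingType) (B : lmodType R^c -> Prop) (n : nat) :
  sup_dim (@fd_right R) B <> Infty ->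
  le_enat (sup_dim (@fd_left R) (@injective_module R)) (Fin n) ->
  le_enat (lwGgl B) (Fin n).
Proof.
move=> Bfd Ifd.
have Bfin : finite_flat_dim B.
  case E : (sup_dim _ B) Bfd => [m|] // _ A BA.
  have /sup_dim_leP/(_ A BA)/inf_enat_leP[k _ Ak] :
      le_enat (sup_dim (@fd_right R) B) m.
    by rewrite E /=.
  by exists k; apply: resolved_of_resolution Ak; apply: flat_right_iso.
apply/sup_dim_leP => M _; apply/inf_enat_leP; exists n => //.
apply/resolution_of_resolved/resolved_gorenstein_flat => //.
have [C [d [e [Cinj ei eex dex]]]] := enough_injectives M.
exists C, d, e; split=> // j.
have /inf_enat_leP[k kn Ck] := (sup_dim_leP _ _ _).1 Ifd (C j) (Cinj j).
apply: (resolved_flat_leq kn); apply: resolved_of_resolution Ck.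
exact: flat_left_iso.
Qed.
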